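(* Let $a,b,c,d\in\mathbb{R}$ with $b<\frac38a^2$, and suppose that the quartic $x^4+ax^3+bx^2+cx+d$ has four real roots $x_1\ge x_2\ge x_3\ge x_4$ (counted with multiplicity) such that either the four roots are distinct, or exactly two of them are equal (one double root and two simple roots) and $c\neq C_0$. Then: if $C_2\le c\le C_0$, $$\lambda_{\min}\le x_4\le\rho_2,\qquad \sigma_3\le x_3\le-\frac a4,\qquad \rho_2\le x_2\le\phi_2,\qquad \sigma_1\le x_1\le\lambda_{\max};$$ if $C_0\le c\le C_1$, $$\lambda_{\min}\le x_4\le\sigma_3,\qquad \phi_1\le x_3\le\rho_1,\qquad -\frac a4\le x_2\le\sigma_1,\qquad \rho_1\le x_1\le\lambda_{\max}.$$
   Context: Notation, for $b<\frac38a^2$: $C_0=-\frac18a^3+\frac12ab$, $C_1=C_0+\frac{\sqrt3}{72}\sqrt{(3a^2-8b)^3}$, $C_2=C_0-\frac{\sqrt3}{72}\sqrt{(3a^2-8b)^3}$; $\rho_1=-\frac a4+\frac{\sqrt3}{12}\sqrt{3a^2-8b}$, $\rho_2=-\frac a4-\frac{\sqrt3}{12}\sqrt{3a^2-8b}$; $\phi_1=-\frac a4-\frac{\sqrt3}{6}\sqrt{3a^2-8b}$, $\phi_2=-\frac a4+\frac{\sqrt3}{6}\sqrt{3a^2-8b}$; $\sigma_1=-\frac a4+\frac14\sqrt{3a^2-8b}$, $\sigma_3=-\frac a4-\frac14\sqrt{3a^2-8b}$; $\lambda_{\max}=-\frac a4+\frac{\sqrt3}{4}\sqrt{3a^2-8b}$,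 $\lambda_{\min}=-\frac a4-\frac{\sqrt3}{4}\sqrt{3a^2-8b}$. *)

(* Defs.v *)
From mathcomp Require Import all_boot all_order all_algebra.
From mathcomp Require Import reals.
Set Implicit Arguments.
Unset Strict Implicit.
Unset Printing Implicit Defensive.
Import Order.TTheory GRing.Theory Num.Theory.
Local Open Scope ring_scope.

Definition quartic (R : realType) (a b c d : R) : {poly R} :=
  'X^4 + a *: 'X^3 + b *: 'X^2 + c *: 'X + d%:P.

Definition real_roots_of (R : realType) (p : {poly R}) (s : seq R) : Prop :=
  p = \prod_(x <- s) ('X - x%:P).

Definition one_double_two_simple (R : realType) (s : seq R) : Prop :=
  exists u v w : R, uniq [:: u; v; w] /\ perm_eq s [:: u; u; v; w].

Section Constants.
Variables (R : realType) (a b : R).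

Definition C0 : R := - (1 / 8) * a ^+ 3 + 1 / 2 * a * b.
Definition C1 : R :=
  C0 + Num.sqrt 3 / 72 * Num.sqrt ((3 * a ^+ 2 - 8 * b) ^+ 3).
Definition C2 : R :=
  C0 - Num.sqrt 3 / 72 * Num.sqrt ((3 * a ^+ 2 - 8 * b) ^+ 3).

Definition rho1 : R := - (a / 4) + Num.sqrt 3 / 12 * Num.sqrt (3 * a ^+ 2 - 8 * b).
Definition rho2 : R := - (a / 4) - Num.sqrt 3 / 12 * Num.sqrt (3 * a ^+ 2 - 8 * b).

Definition phi1 : R := - (a / 4) - Num.sqrt 3 / 6 * Num.sqrt (3 * a ^+ 2 - 8 * b).
Definition phi2 : R := - (a / 4) + Num.sqrt 3 / 6 * Num.sqrt (3 * a ^+ 2 - 8 * b).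

Definition sigma1 : R := - (a / 4) + 1 / 4 * Num.sqrt (3 * a ^+ 2 - 8 * b).
Definition sigma3 : R := - (a / 4) - 1 / 4 * Num.sqrt (3 * a ^+ 2 - 8 * b).

Definition lambda_max : R :=
  - (a / 4) + Num.sqrt 3 / 4 * Num.sqrt (3 * a ^+ 2 - 8 * b).
Definition lambda_min : R :=
  - (a / 4) - Num.sqrt 3 / 4 * Num.sqrt (3 * a ^+ 2 - 8 * b).

End Constants.

(* Main.v *)
Require Import Defs.
From mathcomp Require Import all_boot all_order all_algebra.
From mathcomp Require Import reals.
From mathcomp Require Import ring lra.
Set Implicit Arguments.
Unset Strict Implicit.
Unset Printing Implicit Defensive.
Import Order.TTheory GRing.Theory Num.Theory.
Local Open Scope ring_scope.

(** Translating by [a / 4] kills the cubic coefficient: the numbers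
    [y_i = x_i + a / 4] have sum [0], their squares add up to [D ^+ 2 / 4] with
    [D = Num.sqrt (3 * a ^+ 2 - 8 * b)], and their third elementary symmetric
    function is [C0 a b - c].  Since the sum vanishes, that function factors as
    [(y1 + y2) * (y1 + y3) * (y1 + y4)].  Hence, for ordered roots, [c <= C0 a b]
    forces [0 <= y1 + y4].

    Put [u = y1 + y2], [v = y1 + y3], [w = y1 + y4].  In the case [c <= C0 a b]
    these satisfy [u >= v >= w >= 0] and [u ^+ 2 + v ^+ 2 + w ^+ 2 = D ^+ 2 / 4],
    while each [y_i] is half of a signed sum [+-u +-v +-w].  The eight bounds are
    then elementary ([centered_root_bounds]): the extreme ones, [lambda_min] and
    [lambda_max], come from
    [(u + v + w) ^+ 2 <= 3 * (u ^+ 2 + v ^+ 2 + w ^+ 2)]; the bound [sigma1]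
    from [u ^+ 2 + v ^+ 2 + w ^+ 2 <= (u + v + w) ^+ 2]; all the others from
    comparing the signed sum with [u], [w] or [0], the square of [u] lying
    between the mean and the sum of the three squares, and that of [w] being at
    most their mean.  The case [C0 a b <= c] is the first one
    applied to the reflected quadruple [- y4 >= - y3 >= - y2 >= - y1]. *)

(** Both sides are monic quartics, so their lower coefficients are determined by
    the values at four points. *)
Lemma quartic_vieta (R : realType) (a b c d x1 x2 x3 x4 : R) :
  real_roots_of (quartic a b c d) [:: x1; x2; x3; x4] ->
  [/\ a = - (x1 + x2 + x3 + x4),
      b = x1 * x2 + x1 * x3 + x1 * x4 + x2 * x3 + x2 * x4 + x3 * x4 &
      c = - (x1 * x2 * x3 + x1 * x2 * x4 + x1 * x3 * x4 + x2 * x3 * x4)].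
Proof.
rewrite /real_roots_of /quartic !big_cons big_nil mulr1 => pE.
have evalE t : t ^+ 4 + a * t ^+ 3 + b * t ^+ 2 + c * t + d
               = (t - x1) * ((t - x2) * ((t - x3) * (t - x4))).
  by move/(congr1 (horner^~ t)): pE; rewrite !hornerE.
have e0 := evalE 0; have e1 := evalE 1; have em1 := evalE (- 1).
have e2 := evalE 2.
by split; lra.
Qed.

(** The product of the pairwise sums with [y1] is the third elementary symmetric
    function, and if [y1 + y4] were negative, then [y2 + y3] and with it the two
    other factors would be positive. *)
Lemma centered_outer_sum_ge0 (R : realFieldType) (y1 y2 y3 y4 : R) :
  y1 >= y2 -> y2 >= y3 -> y1 + y2 + y3 + y4 = 0 ->
  0 <= y1 * y2 * y3 + y1 * y2 * y4 + y1 * y3 * y4 + y2 * y3 * y4 ->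
  0 <= y1 + y4.
Proof.
move=> h12 h23 hsum; have y4E : y4 = - (y1 + y2 + y3) by lra.
have -> : y1 * y2 * y3 + y1 * y2 * y4 + y1 * y3 * y4 + y2 * y3 * y4
          = (y1 + y2) * (y1 + y3) * (y1 + y4) by rewrite y4E; ring.
move=> he3; rewrite leNgt; apply/negP => hneg.
have h12_gt0 : 0 < y1 + y2 by lra.
have h13_gt0 : 0 < y1 + y3 by lra.
by move: he3; rewrite pmulr_rge0 ?mulr_gt0 // leNgt hneg.
Qed.

(** [k] stands for [Num.sqrt 3 * D]; it is characterised by its square so that
    the bounds can be proved by squaring. *)
Lemma centered_root_bounds (R : realFieldType) (D k y1 y2 y3 y4 : R) :
  0 <= D -> 0 <= k -> k ^+ 2 = 3 * D ^+ 2 ->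
  y1 >= y2 -> y2 >= y3 -> y3 >= y4 -> y1 + y2 + y3 + y4 = 0 ->
  4 * (y1 ^+ 2 + y2 ^+ 2 + y3 ^+ 2 + y4 ^+ 2) = D ^+ 2 ->
  0 <= y1 * y2 * y3 + y1 * y2 * y4 + y1 * y3 * y4 + y2 * y3 * y4 ->
  [/\ - (k / 4) <= y4 <= - (k / 12),
      - (D / 4) <= y3 <= 0,
      - (k / 12) <= y2 <= k / 6 &
      D / 4 <= y1 <= k / 4].
Proof.
move=> D0 k0 kE h12 h23 h34 hsum hsq he3.
have w0 := centered_outer_sum_ge0 h12 h23 hsum he3.
have le_sqr (s t : R) : 0 <= t -> s ^+ 2 <= t ^+ 2 -> s <= t.
  move=> t0 st; apply: le_trans (ler_norm s) _.
  by rewrite -ler_sqr ?nnegrE // real_normK ?num_real.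
pose u := y1 + y2; pose v := y1 + y3; pose w := y1 + y4.
have uv : v <= u by rewrite /u /v; lra.
have vw : w <= v by rewrite /v /w; lra.
rewrite -/w in w0.
have y1E : y1 = (u + v + w) / 2 by rewrite /u /v /w; lra.
have y2E : y2 = (u - v - w) / 2 by rewrite /u /v /w; lra.
have y3E : y3 = (v - u - w) / 2 by rewrite /u /v /w; lra.
have y4E : y4 = (w - u - v) / 2 by rewrite /u /v /w; lra.
move: hsq; rewrite {}y1E {}y2E {}y3E {}y4E.
move: u v w uv vw w0 => u v w uv vw w0 {h12 h23 h34 hsum he3 y1 y2 y3 y4} hsq.
have DE : D ^+ 2 = 4 * (u ^+ 2 + v ^+ 2 + w ^+ 2) by rewrite -hsq; field.
have v0 : 0 <= v by lra.
have u0 : 0 <= u by lra.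
have vu2 : v ^+ 2 <= u ^+ 2 by rewrite ler_sqr ?nnegrE.
have wv2 : w ^+ 2 <= v ^+ 2 by rewrite ler_sqr ?nnegrE.
have w2 := sqr_ge0 w.
have uv0 := mulr_ge0 u0 v0; have uw0 := mulr_ge0 u0 w0.
have vw0 := mulr_ge0 v0 w0.
have d1 := sqr_ge0 (u - v); have d2 := sqr_ge0 (u - w).
have d3 := sqr_ge0 (v - w).
(* Each comparison is squared; the right-hand sides have these constants because
   [D ^+ 2] is four times and [k ^+ 2] twelve times the sum of the squares. *)
have u_leD : 2 * u <= D by apply: le_sqr => //; lra.
have u_le_k : 3 * u <= k by apply: le_sqr => //; rewrite kE DE; lra.
have k_le_u : k <= 6 * u.
  by apply: le_sqr; [lra | rewrite kE DE; lra].
have w_le_k : 6 * w <= k by apply: le_sqr => //; rewrite kE DE; lra.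
have D_le_sum : D <= 2 * (u + v + w).
  by apply: le_sqr; [lra | rewrite DE; lra].
have sum_le_k : 2 * (u + v + w) <= k by apply: le_sqr => //; rewrite kE DE; lra.
by split; apply/andP; split; lra.
Qed.

Theorem mainTheorem4 (R : realType) (a b c d x1 x2 x3 x4 : R)
    (hb : b < 3 / 8 * a ^+ 2)
    (hroots : real_roots_of (quartic a b c d) [:: x1; x2; x3; x4])
    (hord : [/\ x1 >= x2, x2 >= x3 & x3 >= x4])
    (hmult : uniq [:: x1; x2; x3; x4] \/
             (one_double_two_simple [:: x1; x2; x3; x4] /\ c <> C0 a b)) :
  (C2 a b <= c <= C0 a b ->
     [/\ lambda_min a b <= x4 <= rho2 a b,
         sigma3 a b <= x3 <= - (a / 4),
         rho2 a b <= x2 <= phi2 a b &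
         sigma1 a b <= x1 <= lambda_max a b]) /\
  (C0 a b <= c <= C1 a b ->
     [/\ lambda_min a b <= x4 <= sigma3 a b,
         phi1 a b <= x3 <= rho1 a b,
         - (a / 4) <= x2 <= sigma1 a b &
         rho1 a b <= x1 <= lambda_max a b]).
Proof.
have [aE bE cE] := quartic_vieta hroots.
have [h12 h23 h34] := hord.
have disc0 : 0 <= 3 * a ^+ 2 - 8 * b by lra.
rewrite /lambda_min /lambda_max /rho1 /rho2 /sigma1 /sigma3 /phi1 /phi2.
set D : R := Num.sqrt (3 * a ^+ 2 - 8 * b); set r : R := Num.sqrt 3.
have D0 : 0 <= D by exact: sqrtr_ge0.
have D2 : D ^+ 2 = 3 * a ^+ 2 - 8 * b by exact: sqr_sqrtr.
have k0 : 0 <= r * D by rewrite mulr_ge0 ?sqrtr_ge0.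
have k2 : (r * D) ^+ 2 = 3 * D ^+ 2 by rewrite exprMn sqr_sqrtr ?ler0n.
pose y1 := x1 + a / 4; pose y2 := x2 + a / 4.
pose y3 := x3 + a / 4; pose y4 := x4 + a / 4.
have hsum : y1 + y2 + y3 + y4 = 0 by rewrite /y1 /y2 /y3 /y4 aE; field.
have hsq : 4 * (y1 ^+ 2 + y2 ^+ 2 + y3 ^+ 2 + y4 ^+ 2) = D ^+ 2.
  by rewrite D2 /y1 /y2 /y3 /y4 bE aE; field.
have he3 : y1 * y2 * y3 + y1 * y2 * y4 + y1 * y3 * y4 + y2 * y3 * y4
           = C0 a b - c.
  by rewrite /C0 /y1 /y2 /y3 /y4 cE bE aE; field.
have [y1E y2E] : y1 = x1 + a / 4 /\ y2 = x2 + a / 4 by [].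
have [y3E y4E] : y3 = x3 + a / 4 /\ y4 = x4 + a / 4 by [].
clearbody y1 y2 y3 y4.
have g12 : y2 <= y1 by lra.
have g23 : y3 <= y2 by lra.
have g34 : y4 <= y3 by lra.
clear aE bE cE disc0 D2 hb hroots hord hmult.
split=> /andP[hc1 hc2].
- have e3_ge0 : 0 <= y1 * y2 * y3 + y1 * y2 * y4 + y1 * y3 * y4 + y2 * y3 * y4.
    by rewrite he3 subr_ge0.
  have [/andP[l4 u4] /andP[l3 u3] /andP[l2 u2] /andP[l1 u1]] :=
    centered_root_bounds D0 k0 k2 g12 g23 g34 hsum hsq e3_ge0.
  by split; apply/andP; split; lra.
- have [/andP[l1 u1] /andP[l2 u2] /andP[l3 u3] /andP[l4 u4]] :
    [/\ - (r * D / 4) <= - y1 <= - (r * D / 12), - (D / 4) <= - y2 <= 0,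
        - (r * D / 12) <= - y3 <= r * D / 6 & D / 4 <= - y4 <= r * D / 4].
    by apply: centered_root_bounds => //; rewrite ?lerN2 ?sqrrN //; lra.
  by split; apply/andP; split; lra.
Qed.
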